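(* Let $\underline{A},\overline{A}\in\mathbb{R}^{n\times n}$ with $\underline{A}\le\overline{A}$ (entrywise), let $\mathbf{A}=\{A\in\mathbb{R}^{n\times n} : \underline{A}\le A\le\overline{A}\}$, and let $A^c=\frac12(\underline{A}+\overline{A})$, $A^\Delta=\frac12(\overline{A}-\underline{A})$. Assume that $A^c$ is an $M$-matrix and $A^\Delta$ is irreducible. Then $\mathbf{A}$ is strongly column sufficient if and only if $\underline{A}$ is an $M_0$-matrix.
   Context: Inequalities between vectors or matrices are entrywise; $x\lneqq y$ means $x\le y$ and $x\ne y$. A matrix property holds strongly for an interval matrix $\mathbf{A}$ if it holds for every $A\in\mathbf{A}$. For index sets $I,J$, $A_{I,J}$ is the submatrix of $A$ with rows indexed by $I$ and columns indexed by $J$. A matrix $A\in\mathbb{R}^{n\times n}$ is column sufficient if for each pair of disjoint index sets $I,J\subseteq\{1,\dots,n\}$ with $I\cup J\ne\emptyset$ the system $$\begin{pmatrix}A_{I,I}&-A_{I,J}\\-A_{J,I}&A_{J,J}\end{pmatrix}x\lneqq0,\quad x>0$$ is infeasible. A matrix $A$ is an $M$-matrix (respectively, $M_0$-matrix) if $A=sI_n-N$ for some $N\ge0$ and $s\in\mathbb{R}$ with $s>\rho(N)$ (respectively, $s\ge\rho(N)$), where $\rho$ is the spectral radius. A nonnegative matrix $A\in\mathbb{R}^{n\times n}$ is irreducible if $(I_n+A)^{n-1}>0$; equivalently, $P^TAP$ is block triangular (with at least two blocks) for no permutation matrix $P$. *)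

(* Defs.v *)
From mathcomp Require Import all_boot all_order all_algebra.
From mathcomp Require Import complex.
From mathcomp Require Import classical_sets reals.

Set Implicit Arguments.
Unset Strict Implicit.
Unset Printing Implicit Defensive.

Import Order.TTheory GRing.Theory Num.Theory.
Local Open Scope ring_scope.

Definition mx_le (R : realType) m n (A B : 'M[R]_(m, n)) : Prop :=
  forall i j, A i j <= B i j.

(* Strict in every entry; not the strict part of [mx_le], which is
   [mx_lneq]. *)
Definition mx_lt (R : realType) m n (A B : 'M[R]_(m, n)) : Prop :=
  forall i j, A i j < B i j.

Definition mx_lneq (R : realType) m n (A B : 'M[R]_(m, n)) : Prop :=
  mx_le A B /\ A <> B.

Definition interval_mx (R : realType) m n (Al Au : 'M[R]_(m, n)) :
    set 'M[R]_(m, n) :=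
  [set A | mx_le Al A /\ mx_le A Au]%classic.

Definition mx_center (R : realType) m n (Al Au : 'M[R]_(m, n)) :
    'M[R]_(m, n) :=
  2^-1 *: (Al + Au).

Definition mx_radius (R : realType) m n (Al Au : 'M[R]_(m, n)) :
    'M[R]_(m, n) :=
  2^-1 *: (Au - Al).

Definition strongly (R : realType) m n (P : 'M[R]_(m, n) -> Prop)
    (IA : set 'M[R]_(m, n)) : Prop :=
  forall A, IA A -> P A.

(* [enum_val] lists the elements of an index set (in increasing order). *)
Definition submx_on (R : realType) m n (A : 'M[R]_(m, n))
    (I : {set 'I_m}) (J : {set 'I_n}) : 'M[R]_(#|I|, #|J|) :=
  mxsub enum_val enum_val A.

Definition column_sufficient (R : realType) n (A : 'M[R]_n) : Prop :=
  forall I J : {set 'I_n}, [disjoint I & J] -> I :|: J != finset.set0 ->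
  ~ exists x : 'cV[R]_(#|I| + #|J|),
      mx_lneq (block_mx (submx_on A I I) (- submx_on A I J)
                        (- submx_on A J I) (submx_on A J J) *m x) 0
      /\ mx_lt 0 x.

(* The eigenvalues are the complex ones.  There are finitely many, so for
   0 < n the supremum is a maximum; for n = 0 it is [sup set0 = 0]. *)
Definition spectral_radius (R : realType) n (A : 'M[R]_n) : R :=
  sup [set Normc.normc z |
         z in [set z : R[i] | eigenvalue (map_mx (real_complex R) A) z]]%classic.

Definition M_matrix (R : realType) n (A : 'M[R]_n) : Prop :=
  exists (s : R) (N : 'M[R]_n),
    [/\ mx_le 0 N, A = s%:M - N & spectral_radius N < s].

Definition M0_matrix (R : realType) n (A : 'M[R]_n) : Prop :=
  exists (s : R) (N : 'M[R]_n),
    [/\ mx_le 0 N, A = s%:M - N & spectral_radius N <= s].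

Definition irreducible_mx (R : realType) n (A : 'M[R]_n) : Prop :=
  mx_le 0 A /\ mx_lt 0 ((1%:M + A) ^+ n.-1).

(* Main.v *)
(* Write Al = s - N with N >= 0.  If N has an eigenvalue of modulus > s, the
   modulus of an eigenvector is an x >= 0 with Al x < 0 on its support, so Al
   itself is not column sufficient.  Conversely, the off-diagonal entries of
   every A in the interval are bounded in modulus by those of -Al, so a vector
   violating the column sufficiency of A yields z >= 0 with s z <= N z and
   s z <> N z.  Since N dominates the irreducible radius off the diagonal,
   multiplying z by a positive matrix commuting with N gives x >= 0 and t > s
   with t x <= N x, which forces rho(N) >= t.  The last step (half of the
   Collatz-Wielandt characterization) is proved without Perron-Frobenius: the
   infimum of the ratios r for which N y < r y has a positive solution y is an
   eigenvalue of N. *)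
Require Import Defs.
From mathcomp Require Import all_boot all_order all_algebra.
From mathcomp Require Import complex ring lra.
From mathcomp Require Import classical_sets reals.

Set Implicit Arguments.
Unset Strict Implicit.
Unset Printing Implicit Defensive.

Import Order.TTheory GRing.Theory Num.Theory.
Local Open Scope ring_scope.

Lemma exists_pos_scale (R : realFieldType) n (d x : 'I_n -> R) :
  (forall i, 0 < d i) -> exists2 e, 0 < e & forall i, e * x i <= d i.
Proof.
move=> d0.
suff [e e0 he] : exists2 e, 0 < e & forall i, i \in enum 'I_n -> e * x i <= d i.
  by exists e => // i; apply: he; rewrite mem_enum.
elim: (enum 'I_n) => [|i s [e e0 he]]; first by exists 1.
have x1 : 0 < `|x i| + 1 by rewrite ltr_wpDl.
exists (Num.min e (d i / (`|x i| + 1))) => [|j].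
  by rewrite lt_min e0 divr_gt0.
set m := Num.min _ _.
have m0 : 0 < m by rewrite lt_min e0 divr_gt0.
have me : m <= e by rewrite ge_min lexx.
have md : m * (`|x i| + 1) <= d i by rewrite -ler_pdivlMr // ge_min lexx orbT.
rewrite inE => /predU1P[->|/he hj].
  apply: le_trans md; apply: ler_wpM2l; first exact: ltW.
  by rewrite (le_trans (ler_norm _)) // lerDl.
have [xj|xj] := leP 0 (x j).
  by apply: le_trans hj; apply: ler_wpM2r.
by apply: (@le_trans _ _ 0); [rewrite pmulr_rle0 // ltW | exact: ltW].
Qed.

Lemma mulmx_col_ge0 (R : numDomainType) m n (A : 'M[R]_(m, n)) (x : 'cV[R]_n) i :
  (forall i j, 0 <= A i j) -> (forall j, 0 <= x j ord0) -> 0 <= (A *m x) i ord0.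
Proof. by move=> A0 x0; rewrite mxE sumr_ge0 // => j _; rewrite mulr_ge0. Qed.

(** * Sub- and supersolutions of a nonnegative matrix and its spectral radius *)

Section NonnegativeMatrix.

Variables (R : realType) (n : nat) (N : 'M[R]_n).
Hypothesis N_ge0 : forall i j, 0 <= N i j.

(** A certificate that r exceeds every eigenvalue modulus of N; for 0 < n the infimum of such r is
    the Perron root. *)
Definition strict_supersolution (r : R) (y : 'cV[R]_n) : Prop :=
  forall i, 0 < y i ord0 /\ (N *m y) i ord0 < r * y i ord0.

(* At an index minimizing z i / y i = c < 0 the inequality N z >= c N y
   contradicts N y < r y. *)
Lemma comparison_principle r (y z : 'cV[R]_n) :
  strict_supersolution r y ->
  (forall i, (N *m z) i ord0 <= r * z i ord0) -> forall i, 0 <= z i ord0.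
Proof.
move=> hy hz i0; rewrite leNgt; apply/negP => zi0.
have y0 i : 0 < y i ord0 by case: (hy i).
have [//|i _ imin] :=
  @Order.TotalTheory.arg_minP _ _ _ i0 predT (fun i => z i ord0 / y i ord0).
set c := z i ord0 / y i ord0.
have c0 : c < 0.
  by apply: le_lt_trans (imin i0 isT) _; rewrite pmulr_llt0 // invr_gt0.
have zc j : c * y j ord0 <= z j ord0 by rewrite -ler_pdivlMr //; exact: imin.
have zi : z i ord0 = c * y i ord0 by rewrite mulfVK // gt_eqF.
have le1 : c * (N *m y) i ord0 <= (N *m z) i ord0.
  rewrite !mxE mulr_sumr; apply: ler_sum => j _.
  by rewrite mulrCA ler_wpM2l.
have lt2 : c * (r * y i ord0) < c * (N *m y) i ord0.
  by rewrite ltr_nM2l //; case: (hy i).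
have := hz i; rewrite zi mulrCA => le3.
by have := lt_le_trans lt2 (le_trans le1 le3); rewrite ltxx.
Qed.

(** If r <= t, then N (-x) <= r (-x), and the comparison principle would make -x nonnegative. *)
Lemma subsolution_lt t r (x y : 'cV[R]_n) i0 :
  strict_supersolution r y ->
  (forall i, 0 <= x i ord0) -> 0 < x i0 ord0 ->
  (forall i, t * x i ord0 <= (N *m x) i ord0) -> t < r.
Proof.
move=> hy x0 xi0 tx; rewrite ltNge; apply/negP => rt.
have : 0 <= (- x) i0 ord0.
  apply: comparison_principle hy _ _ => i.
  rewrite mulmxN !mxE mulrN lerN2.
  have := tx i; rewrite mxE; apply: le_trans; exact: ler_wpM2r.
by rewrite mxE oppr_ge0 leNgt xi0.
Qed.

Lemma strict_supersolution_const :
  strict_supersolution (1 + \sum_i \sum_j N i j) (const_mx 1).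
Proof.
move=> i; rewrite !mxE ltr01; split => //; rewrite mulr1.
under eq_bigr do rewrite mxE mulr1.
rewrite [X in 1 + X](bigD1 i) //= addrCA ltrDl.
by rewrite ltr_pwDl // sumr_ge0 // => k _; rewrite sumr_ge0.
Qed.

(* The infimum r of the set of all ratios admitting a strict supersolution is
   an eigenvalue: if r - N were invertible, then by the comparison principle
   (r - N)^-1 1 would be a strict supersolution for ratios below r. *)
Lemma subsolution_real_eigenvalue t (x : 'cV[R]_n) i0 :
  (forall i, 0 <= x i ord0) -> 0 < x i0 ord0 ->
  (forall i, t * x i ord0 <= (N *m x) i ord0) ->
  exists2 r, t <= r & eigenvalue N r.
Proof.
move=> x0 xi0 tx.
pose T := [set r | exists y, strict_supersolution r y]%classic.
have Tlb : lbound T t.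
  by move=> r [y hy]; apply: ltW; apply: subsolution_lt hy x0 xi0 tx.
have Tn0 : (T !=set0)%classic.
  by exists (1 + \sum_i \sum_j N i j); exists (const_mx 1);
    exact: strict_supersolution_const.
have Tl : has_lbound T by exists t.
set r := inf T.
exists r; first exact: lb_le_inf.
have [rN|rN] := boolP ((r%:M - N) \in unitmx); last first.
  have /det0P[v v0 hv] : \det (r%:M - N) == 0.
    by move: rN; rewrite unitmxE unitfE negbK.
  apply/eigenvalueP; exists v => //.
  by apply/esym/eqP; rewrite -subr_eq0 -mul_mx_scalar -mulmxBr hv.
exfalso.
pose z : 'cV[R]_n := invmx (r%:M - N) *m const_mx 1.
have zE i : r * z i ord0 - (N *m z) i ord0 = 1.
  have : (r%:M - N) *m z = const_mx 1 by rewrite mulmxA mulmxV // mul1mx.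
  move/matrixP/(_ i ord0).
  by rewrite mulmxBl mul_scalar_mx [LHS]mxE [in LHS]mxE [X in _ + X]mxE [RHS]mxE.
(* The bound 1/2 leaves slack in r z - N z = 1 for moving r by at most e: upwards to some r' in [T],
   which gives z >= 0, and downwards to r - e, which contradicts the infimum. *)
have [e e0 he] : exists2 e, 0 < e & forall i, e * `|z i ord0| <= 2^-1.
  by apply: exists_pos_scale => i; rewrite invr_gt0 ltr0n.
have he2 i : - (2^-1) <= e * z i ord0 <= 2^-1.
  by rewrite -ler_norml normrM gtr0_norm.
have [r' [y hy] r'r] := inf_adherent e0 (conj Tn0 Tl).
have rr' : r <= r' by apply: ge_inf => //; exists y.
have z0 i : 0 <= z i ord0.
  apply: comparison_principle hy _ _ => {}i.
  have ze := zE i.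
  suff : - 1 <= (r' - r) * z i ord0 by lra.
  suff : `|(r' - r) * z i ord0| <= 2^-1 by rewrite ler_norml; lra.
  rewrite normrM; apply: le_trans (he i); apply: ler_wpM2r => //.
  by rewrite ger0_norm; rewrite /r in rr' *; lra.
have zp i : 0 < z i ord0.
  rewrite lt_neqAle z0 andbT; apply/eqP => zi.
  have := zE i; rewrite -zi mulr0.
  have := @mulmx_col_ge0 _ _ _ N z i N_ge0 z0; lra.
have : T (r - e).
  exists z => i; split => //.
  by have := zE i; have := he2 i; rewrite mulrBl; lra.
by move/(ge_inf Tl); rewrite -/r; lra.
Qed.

(** Triangle inequality in each row of N w = z w, with x the entrywise modulus of w. *)
Lemma eigenvalue_subsolution (z : R[i]) :
  eigenvalue (map_mx (real_complex R) N) z ->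
  exists x : 'cV[R]_n, [/\ forall i, 0 <= x i ord0, exists i, 0 < x i ord0 &
    forall i, Normc.normc z * x i ord0 <= (N *m x) i ord0].
Proof.
set A := map_mx _ N.
case/eigenvalueP => v hv v0.
have : \det (A - z%:M) == 0.
  by apply/det0P; exists v => //; rewrite mulmxBr hv mul_mx_scalar subrr.
(* [eigenvalue] refers to row vectors; transposing the determinant yields the transpose w of a right
   eigenvector. *)
rewrite -det_tr => /det0P[w w0 hw].
have wE i : \sum_j A i j * w ord0 j = z * w ord0 i.
  have /matrixP/(_ ord0 i) : w *m A^T = z *: w.
    by apply/eqP; rewrite -subr_eq0 -mul_mx_scalar -mulmxBr
      -(tr_scalar_mx _ z) -linearB hw.
  by rewrite !mxE => <-; apply: eq_bigr => j _; rewrite !mxE mulrC.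
exists (\col_i Normc.normc (w ord0 i)); split => [i||i].
- by rewrite mxE /Normc.normc; case: (w _ _) => a b; exact: sqrtr_ge0.
- have /rV0Pn[i wi] := w0.
  exists i; rewrite mxE lt_neqAle eq_sym; apply/andP; split.
    by apply: contra wi => /eqP /Normc.eq0_normc ->.
  by rewrite /Normc.normc; case: (w _ _) => a b; exact: sqrtr_ge0.
- rewrite mxE -Normc.normcM -wE mxE -lecR.
  have nE (u : R[i]) : (Normc.normc u)%:C%C = `|u| by [].
  rewrite nE raddf_sum; apply: le_trans (ler_norm_sum _ _ _) _.
  apply: ler_sum => j _; rewrite !mxE /= rmorphM /= nE normrM; apply: ler_wpM2r => //.
  by rewrite ger0_norm // lecR.
Qed.

(** [sup] bounds its set only once the set is known to be bounded; the constant supersolution bounds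
    all moduli. *)
Lemma spectral_radius_has_ubound : has_ubound [set Normc.normc z |
  z in [set z : R[i] | eigenvalue (map_mx (real_complex R) N) z]]%classic.
Proof.
exists (1 + \sum_i \sum_j N i j) => _ [z /eigenvalue_subsolution[x []]] + + + <-.
move=> x0 [i xi] zx; apply: ltW.
exact: subsolution_lt strict_supersolution_const x0 xi zx.
Qed.

Lemma spectral_radius_ge0 : 0 <= spectral_radius N.
Proof.
rewrite /spectral_radius; set S := (X in sup X).
have [->|/set0P[a Sa]] := eqVneq S set0%classic; first by rewrite sup0.
apply: le_trans (ub_le_sup spectral_radius_has_ubound Sa).
by case: Sa => -[b c] _ <-; exact: sqrtr_ge0.
Qed.

(** The hypothesis [0 <= s] covers an empty set of eigenvalues (n = 0), whose [sup] is 0. *)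
Lemma spectral_radius_le s : 0 <= s ->
  (forall z, eigenvalue (map_mx (real_complex R) N) z -> Normc.normc z <= s) ->
  spectral_radius N <= s.
Proof.
move=> s0 hs; rewrite /spectral_radius; set S := (X in sup X).
have [->|/set0P S0] := eqVneq S set0%classic; first by rewrite sup0.
by apply: ge_sup => // _ [z /hs ? <-].
Qed.

Lemma subsolution_le_spectral_radius t (x : 'cV[R]_n) i0 :
  (forall i, 0 <= x i ord0) -> 0 < x i0 ord0 ->
  (forall i, t * x i ord0 <= (N *m x) i ord0) -> t <= spectral_radius N.
Proof.
move=> x0 xi0 tx.
have [r tr /eigenvalueP[v hv v0]] := subsolution_real_eigenvalue x0 xi0 tx.
apply: le_trans tr _; apply: (@le_trans _ _ (Normc.normc r%:C%C)).
  by rewrite /Normc.normc /= expr0n /= addr0 sqrtr_sqr ler_norm.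
apply: (ub_le_sup spectral_radius_has_ubound); exists r%:C%C => //=.
apply/eigenvalueP; exists (map_mx (real_complex R) v).
  by rewrite -map_mxM hv map_mxZ.
by rewrite map_mx_eq0.
Qed.

End NonnegativeMatrix.

(** * Necessity: from column sufficiency to a spectral bound *)

(** [colsub enum_val 1%:M] extends a vector on J by zero, so products with blocks become products
    with A. *)
Lemma submx_on_mulmx (R : realType) m n (A : 'M[R]_(m, n)) (I : {set 'I_m})
    (J : {set 'I_n}) (x : 'cV[R]_#|J|) :
  submx_on A I J *m x = rowsub enum_val (A *m (colsub enum_val 1%:M *m x)).
Proof.
rewrite mulmxA mulmx_colsub mulmx1 -mul_rowsub_mx; congr (_ *m _).
by apply/matrixP => i j; rewrite !mxE.
Qed.

Lemma colsub1_rowsub (R : realType) n (J : {set 'I_n}) (x : 'cV[R]_n) :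
  (forall i, i \notin J -> x i ord0 = 0) ->
  colsub (@enum_val _ (mem J)) 1%:M *m rowsub enum_val x = x.
Proof.
move=> xJ; apply/matrixP => i k; rewrite ord1 {k} mxE.
under eq_bigr do rewrite !mxE.
rewrite -(big_enum_val (A := mem J) (fun j => (i == j)%:R * x j ord0)) /=.
have [iJ|iJ] := boolP (i \in J).
  rewrite (bigD1 i) //= eqxx mul1r big1 ?addr0 // => j /andP[_ ji].
  by rewrite eq_sym (negbTE ji) mul0r.
rewrite xJ // big1 // => j jJ; case: eqP => [ij|]; last by rewrite mul0r.
by rewrite ij jJ in iJ.
Qed.

(* The modulus x of an eigenvector with |z| > s satisfies A x < 0 on its
   support, which is the index set violating column sufficiency. *)
Lemma column_sufficient_spectral_radius_le (R : realType) n (s : R)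
    (N : 'M[R]_n) :
  mx_le 0 N -> 0 <= s -> column_sufficient (s%:M - N) -> spectral_radius N <= s.
Proof.
move=> N0 s0 cs; have N_ge0 i j : 0 <= N i j by have := N0 i j; rewrite mxE.
apply: spectral_radius_le => // z hz; rewrite leNgt; apply/negP => sz.
have [x [x0 [i0 xi0] zx]] := eigenvalue_subsolution N_ge0 hz.
set A := s%:M - N.
have Ax i : 0 < x i ord0 -> (A *m x) i ord0 < 0.
  move=> xi; have := zx i.
  have : s * x i ord0 < Normc.normc z * x i ord0 by rewrite ltr_pM2r.
  rewrite mulmxBl mul_scalar_mx [X in _ -> _ -> X < _]mxE.
  by rewrite [X in _ -> _ -> X + _ < _]mxE [X in _ -> _ -> _ + X < _]mxE; lra.
pose I := finset (fun i : 'I_n => 0 < x i ord0).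
have xI i : i \notin I -> x i ord0 = 0.
  by rewrite inE -leNgt => xi; apply/eqP; rewrite eq_le xi x0.
apply: (cs I finset.set0).
- by rewrite -setI_eq0 finset.setI0.
- by rewrite finset.setU0; apply/set0Pn; exists i0; rewrite inE.
have J0 (k : 'I_#|@finset.set0 'I_n|) : False.
  by have := ltn_ord k; rewrite [X in (_ < X)%N]cards0.
(* The second index set is empty, so the lower block has no rows. *)
exists (col_mx (rowsub enum_val x) (const_mx 1)); split; last first.
  move=> k j; rewrite ord1 -(splitK k); case: (split k) => [a|b] /=.
    by rewrite col_mxEu !mxE; have := enum_valP a; rewrite inE.
  by case: (J0 b).
rewrite mul_block_col; set B := _ *m _ + _.
have BE a : B a ord0 < 0.
  rewrite /B mxE [X in _ + X]mxE big1 => [|k _]; last by case: (J0 k).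
  rewrite addr0 submx_on_mulmx colsub1_rowsub // mxE; apply: Ax.
  by have := enum_valP a; rewrite inE.
split.
  move=> k j; rewrite ord1 -(splitK k); case: (split k) => [a|b] /=.
    by rewrite col_mxEu [leRHS]mxE ltW.
  by case: (J0 b).
move=> /matrixP/(_ (lshift _ (enum_rank_in (_ : i0 \in I) i0)) ord0).
have iI : i0 \in I by rewrite inE.
move=> /(_ iI); rewrite col_mxEu => h; have := BE (enum_rank_in iI i0).
by rewrite h mxE ltxx.
Qed.

(** * Sufficiency: irreducibility and comparison with the lower bound *)

Lemma mx_exp_ge0_le (R : realType) n (A B : 'M[R]_n) k :
  mx_le 0 A -> mx_le A B -> mx_le 0 (A ^+ k) /\ mx_le (A ^+ k) (B ^+ k).
Proof.
move=> A0 AB; elim: k => [|k [IH1 IH2]].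
  by split => // i j; rewrite expr0 !mxE ler0n.
have A0' i j : 0 <= A i j by have := A0 i j; rewrite mxE.
have Ak0 i j : 0 <= (A ^+ k) i j by have := IH1 i j; rewrite mxE.
rewrite !exprS; split => i j.
  by rewrite !mxE sumr_ge0 // => l _; rewrite mulr_ge0.
by rewrite !mxE; apply: ler_sum => l _; apply: ler_pM.
Qed.

(* The positive matrix ((1 + tr D) + N)^(n-1) commutes with N and turns
   0 <> N z - s z >= 0 into a strict inequality, which leaves room for a
   factor larger than s. *)
Lemma irreducible_subsolution_lt_spectral_radius (R : realType) n
    (D N : 'M[R]_n) (s : R) (z : 'cV[R]_n) i0 :
  irreducible_mx D -> mx_le 0 N -> (forall i j, i != j -> D i j <= N i j) ->
  (forall i, 0 <= z i ord0) ->
  (forall i, s * z i ord0 <= (N *m z) i ord0) ->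
  s * z i0 ord0 < (N *m z) i0 ord0 -> s < spectral_radius N.
Proof.
move=> [D0 Dpos] N0 DN z0 sz szi0.
have N_ge0 i j : 0 <= N i j by have := N0 i j; rewrite mxE.
have D_ge0 i j : 0 <= D i j by have := D0 i j; rewrite mxE.
(* The shift by [\tr D] makes the base dominate 1 + D on the diagonal too, where D may exceed N. *)
pose P := ((1 + \tr D)%:M + N) ^+ n.-1.
have Ppos i j : 0 < P i j.
  have [| |_ /(_ i j)] := @mx_exp_ge0_le R n (1%:M + D) ((1 + \tr D)%:M + N) n.-1.
  - by move=> k l; rewrite !mxE addr_ge0 // ler0n.
  - move=> k l; rewrite !mxE; have [->|kl] := eqVneq k l; last first.
      by rewrite !add0r DN.
    have : D l l <= \tr D.
      by rewrite /mxtrace (bigD1 l) //= lerDl sumr_ge0.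
    by have := N_ge0 l l; rewrite !mulr1n; lra.
  - by apply: lt_le_trans; have := Dpos i j; rewrite mxE.
have NP : N *m P = P *m N.
  apply: commrX; rewrite /GRing.comm mulrDr mulrDl; congr (_ + _).
  by rewrite -!mulmxE scalar_mxC.
pose d := N *m z - s *: z.
have dE i : d i ord0 = (N *m z) i ord0 - s * z i ord0.
  by rewrite [LHS]mxE [X in _ + X]mxE [in X in _ + X]mxE.
have d0 i : 0 <= d i ord0 by rewrite dE subr_ge0.
pose x := P *m z.
have x0 i : 0 <= x i ord0.
  by apply: mulmx_col_ge0 => // *; apply: ltW.
have NxE : N *m x - s *: x = P *m d.
  by rewrite /x mulmxA NP mulmxBr mulmxA -scalemxAr.
have Pd i : 0 < (P *m d) i ord0.
  rewrite mxE (bigD1 i0) //= ltr_pwDl ?mulr_gt0 // ?dE ?subr_gt0 //.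
  by rewrite sumr_ge0 // => j _; rewrite mulr_ge0 // ltW.
have [i1 xi1] : exists i, 0 < x i ord0.
  apply/existsP; apply: contraT; rewrite negb_exists => /forallP xn.
  have xz : x = 0.
    apply/matrixP => i j; rewrite ord1 [RHS]mxE; apply/eqP.
    by rewrite eq_le x0 andbT leNgt.
  have := Pd i0; rewrite -NxE xz mulmx0 scaler0 subrr mxE ltxx.
  by [].
have [e e0 he] := exists_pos_scale (fun i => x i ord0) Pd.
suff : s + e <= spectral_radius N by lra.
apply: (subsolution_le_spectral_radius N_ge0 x0 xi1) => i.
rewrite mulrDl addrC -lerBrDr; apply: le_trans (he i) _.
by rewrite -NxE [leLHS]mxE [X in _ + X <= _]mxE [in X in _ + X <= _]mxE.
Qed.

(* The nonzero entries of a vector violating column sufficiency of A, made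
   positive, give z >= 0 with A' z <= 0, A' z <> 0. *)
Lemma column_sufficient_of_comparison (R : realType) n (A A' : 'M[R]_n) :
  mx_le A' A ->
  (forall i j, i != j -> A' i j <= - A i j /\ A' i j <= 0) ->
  (forall z : 'cV[R]_n, (forall i, 0 <= z i ord0) ->
     (forall i, (A' *m z) i ord0 <= 0) -> forall i, 0 <= (A' *m z) i ord0) ->
  column_sufficient A.
Proof.
move=> A'A A'off A'z I J IJ _ [x [[]]].
rewrite -(vsubmxK x); set x1 := usubmx x; set x2 := dsubmx x => + + x0.
have x1_gt0 k : 0 < x1 k ord0.
  by have := x0 (lshift _ k) ord0; rewrite col_mxEu mxE.
have x2_gt0 k : 0 < x2 k ord0.
  by have := x0 (rshift _ k) ord0; rewrite col_mxEd mxE.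
rewrite mul_block_col; set B1 := _ *m x1 + _; set B2 := _ *m x1 + _ => B0 Bn.
have B1_le0 a : B1 a ord0 <= 0.
  by have := B0 (lshift _ a) ord0; rewrite col_mxEu [leRHS]mxE.
have B2_le0 a : B2 a ord0 <= 0.
  by have := B0 (rshift _ a) ord0; rewrite col_mxEd [leRHS]mxE.
(* z equals x1 on I, x2 on J and 0 elsewhere. *)
pose z := colsub enum_val 1%:M *m x1 + colsub enum_val 1%:M *m x2.
have z0 i : 0 <= z i ord0.
  rewrite /z mxE addr_ge0 //.
  - by apply: mulmx_col_ge0 => [k l|k]; [rewrite !mxE ler0n | exact: ltW].
  - by apply: mulmx_col_ge0 => [k l|k]; [rewrite !mxE ler0n | exact: ltW].
have zE i : (A' *m z) i ord0 = \sum_k A' i (enum_val k) * x1 k ord0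
                             + \sum_k A' i (enum_val k) * x2 k ord0.
  rewrite mulmxDr !mulmxA !mulmx_colsub mulmx1 !mxE.
  by congr (_ + _); apply: eq_bigr => k _; rewrite mxE.
have IJn i j : i \in I -> j \in J -> i != j.
  by move=> iI jJ; apply/eqP => ij; rewrite ij (disjointFl IJ) in iI.
(* In the rows of I, A' <= A handles the columns of I; by disjointness the columns of J are off the
   diagonal, where A' <= -A. *)
have zB1 a : (A' *m z) (enum_val a) ord0 <= B1 a ord0.
  rewrite zE /B1 !mxE; apply: lerD; apply: ler_sum => k _;
    (apply: ler_wpM2r; [exact: ltW | rewrite ?mxE]); first exact: A'A.
  by have [] := A'off _ _ (IJn _ _ (enum_valP a) (enum_valP k)).
have zB2 a : (A' *m z) (enum_val a) ord0 <= B2 a ord0.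
  rewrite zE /B2 !mxE; apply: lerD; apply: ler_sum => k _;
    (apply: ler_wpM2r; [exact: ltW | rewrite ?mxE]); last exact: A'A.
  have := IJn _ _ (enum_valP k) (enum_valP a).
  by rewrite eq_sym => /A'off[].
(* Outside I and J the support of z meets only off-diagonal entries of A', which are nonpositive. *)
have z_le0 i : (A' *m z) i ord0 <= 0.
  have [iI|iI] := boolP (i \in I).
    by rewrite -(enum_rankK_in iI iI) (le_trans (zB1 _)).
  have [iJ|iJ] := boolP (i \in J).
    by rewrite -(enum_rankK_in iJ iJ) (le_trans (zB2 _)).
  rewrite zE -[leRHS]addr0; apply: lerD; apply: sumr_le0 => k _;
    (apply: mulr_le0_ge0; last exact: ltW).
  - have [|//] := A'off i (enum_val k).
    by apply: contraNneq iI => ->; exact: enum_valP.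
  - have [|//] := A'off i (enum_val k).
    by apply: contraNneq iJ => ->; exact: enum_valP.
have z_ge0 := A'z z z0 z_le0.
(* On both blocks 0 <= A' z <= B <= 0, so the product vanishes. *)
apply: Bn; apply/matrixP => k j; rewrite ord1 -(splitK k) [RHS]mxE.
case: (split k) => [a|a] /=; apply/eqP.
- by rewrite col_mxEu eq_le B1_le0 (le_trans _ (zB1 a)).
- by rewrite col_mxEd eq_le B2_le0 (le_trans _ (zB2 a)).
Qed.

(** The centre s - N has nonpositive off-diagonal entries. With A <= Au this yields Al <= -A off the
    diagonal for every A in the interval. *)
Lemma offdiag_mx_center_le0 (R : realType) n (Al Au N : 'M[R]_n) (s : R) :
  mx_le 0 N -> mx_center Al Au = s%:M - N ->
  forall i j, i != j -> Al i j + Au i j <= 0.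
Proof.
move=> N0 /matrixP cE i j ij; have := cE i j; have := N0 i j.
by rewrite !mxE (negbTE ij) mulr0n; lra.
Qed.

Theorem proposition12 (R : realType) (n : nat) (Al Au : 'M[R]_n)
    (hA : mx_le Al Au)
    (hc : M_matrix (mx_center Al Au))
    (hr : irreducible_mx (mx_radius Al Au)) :
  strongly (@column_sufficient R n) (interval_mx Al Au) <-> M0_matrix Al.
Proof.
have [s0 [N0 [N0_ge0 cE rho0]]] := hc.
split=> [cs | [s [N [N_ge0 AlE rho]]] A [AlA AAu]].
  (* Al is the centre minus the radius, so s0 also serves for Al. *)
  pose N := N0 + mx_radius Al Au.
  have AlE : Al = s0%:M - N.
    rewrite /N opprD addrA -cE; apply/matrixP => i j; rewrite !mxE.
    by field.
  have N_ge0 : mx_le 0 N.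
    move=> i j; rewrite [leLHS]mxE [leRHS]mxE addr_ge0 //.
      by have := N0_ge0 i j; rewrite mxE.
    by have [/(_ i j)] := hr; rewrite [X in X <= _]mxE.
  clearbody N; exists s0, N; split; [exact: N_ge0 | exact: AlE |].
  apply: column_sufficient_spectral_radius_le; first exact: N_ge0.
    apply: le_trans (ltW rho0); apply: spectral_radius_ge0 => i j.
    by have := N0_ge0 i j; rewrite mxE.
  by rewrite -AlE; apply: cs; split.
have off := offdiag_mx_center_le0 N0_ge0 cE.
clear hc cE rho0 N0 N0_ge0.
apply: (@column_sufficient_of_comparison R n A Al) => // [i j ij|z z0 z_le0 i].
  by clear AlE rho; have := off _ _ ij; have := AAu i j; have := hA i j; lra.
have zE k : (Al *m z) k ord0 = s * z k ord0 - (N *m z) k ord0.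
  by rewrite AlE mulmxBl mul_scalar_mx [LHS]mxE [in LHS]mxE [X in _ + X]mxE.
rewrite leNgt; apply/negP => zi.
suff : s < spectral_radius N by rewrite ltNge rho.
apply: (irreducible_subsolution_lt_spectral_radius hr N_ge0 _ z0 (i0 := i)).
(* Off the diagonal N = -Al, and (Au - Al) / 2 <= -Al amounts to Al + Au <= 0. *)
- move=> k l kl; have := off _ _ kl.
  clear rho; move/matrixP/(_ k l): AlE; rewrite !mxE (negbTE kl) mulr0n; lra.
- by move=> k; have := z_le0 k; rewrite zE subr_le0.
- by move: zi; rewrite zE subr_lt0.
Qed.
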